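(* The class $\mathcal{C}_{\text{Pencil}}$ of Pencil frames is not modally definable: there is no formula $\varphi$ of the language $\mathcal{L}_{\Box,\triangleright}$ such that for every Veltman frame $\mathcal{F}$ we have $\mathcal{F}\models\varphi$ if and only if $\mathcal{F}\in\mathcal{C}_{\text{Pencil}}$.
   Context: Formulas of $\mathcal{L}_{\Box,\triangleright}$ are built from a countably infinite set of propositional atoms by the grammar $\alpha ::= p \mid \bot \mid \alpha\to\alpha \mid \Box\alpha \mid \alpha\triangleright\alpha$; the other Boolean connectives are defined as usual, and $\Diamond\alpha := \neg\Box\neg\alpha$. A Veltman frame is a triple $\mathcal{F}=\langle W,R,\{S_w\}_{w\in W}\rangle$ with the following properties. $W$ is a nonempty set. $R$ is a transitive binary relation on $W$ that is conversely well-founded, meaning there is no infinite chain $w_0Rw_1Rw_2R\cdots$. For each $w\in W$, $S_w$ is a reflexive and transitive binary relation on $R[w]:=\{v: wRv\}$ such that for all $u,v\in R[w]$, $uRv$ implies $uS_wv$. A Veltman model adds a valuation $ev$ assigning to each atom a subset of $W$. Forcing is defined as follows: - $w\Vdash p$ iff $w\in ev(p)$. - $w\not\Vdash\bot$. - Implication is classical. - $w\Vdash\Box\alpha$ iff every $v$ with $wRv$ forces $\alpha$. - $w\Vdash\alpha\triangleright\beta$ iff for every $u$ with $wRu$ and $u\Vdash\alpha$ there is $v$ with $uS_wv$ and $v\Vdash\beta$. A frame validates $\varphi$, written $\mathcal{F}\models\varphi$, if $\varphi$ is forced at every world under every valuation. $\mathcal{C}_{\text{Pencil}}$ is the class of Veltman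 frames satisfying: for all $x,y,z,u,v\in W$, if $xRy$, $yS_xz$, $zRu$, $yRv$ and $vS_xu$, then $yRu$. *)

(* Defs.v *)
Inductive formula : Type :=
| Atom : nat -> formula
| Bot : formula
| Imp : formula -> formula -> formula
| Box : formula -> formula
| Rhd : formula -> formula -> formula.

(* [vS w] is a relation on the set R[w]; it is encoded as a relation on all of
   [W] whose field is contained in R[w] ([S_dom]). *)
Record veltman_frame : Type := VeltmanFrame {
  W :> Type;
  vR : W -> W -> Prop;
  vS : W -> W -> W -> Prop;
  W_nonempty : inhabited W;
  R_trans : forall u v w, vR u v -> vR v w -> vR u w;
  R_conv_wf : ~ exists c : nat -> W, forall n : nat, vR (c n) (c (S n));
  S_dom : forall w u v, vS w u v -> vR w u /\ vR w v;
  S_refl : forall w u, vR w u -> vS w u u;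
  S_trans : forall w u v t, vS w u v -> vS w v t -> vS w u t;
  S_incl : forall w u v, vR w u -> vR w v -> vR u v -> vS w u v
}.

Arguments vR {v} _ _ : rename.
Arguments vS {v} _ _ _ : rename.

Definition valuation (F : veltman_frame) : Type := nat -> F -> Prop.

Fixpoint forces (F : veltman_frame) (ev : valuation F) (w : F) (a : formula)
    {struct a} : Prop :=
  match a with
  | Atom p => ev p w
  | Bot => False
  | Imp b c => forces F ev w b -> forces F ev w c
  | Box b => forall v : F, vR w v -> forces F ev v b
  | Rhd b c =>
      forall u : F, vR w u -> forces F ev u b ->
      exists v : F, vS w u v /\ forces F ev v c
  end.

Definition validates (F : veltman_frame) (a : formula) : Prop :=
  forall (ev : valuation F) (w : F), forces F ev w a.

Definition Pencil (F : veltman_frame) : Prop :=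
  forall x y z u v : F,
    vR x y -> vS x y z -> vR z u -> vR y v -> vS x v u -> vR y u.

(* Main.v *)
Require Import Defs.
From Stdlib Require Import Lia.

(** Validity is preserved by surjective bounded morphisms, so it suffices to map
    a Pencil frame onto a frame that is not Pencil.  The minimal frame violating
    the condition has worlds [x, y, z, u, v] with [z R u] and [v S_x u] but not
    [y R u].  Splitting [u] into a copy [u1] that is an R-successor of [z] and a
    copy [u2] that is an S_x-successor of [v] destroys the violation, and
    identifying the two copies is a bounded morphism. *)

Record bounded_morphism (G F : veltman_frame) (f : G -> F) : Prop := {
  bm_R_forth : forall w v, vR w v -> vR (f w) (f v);
  bm_R_back : forall w v', vR (f w) v' -> exists v, vR w v /\ f v = v';
  bm_S_forth : forall w u v, vS w u v -> vS (f w) (f u) (f v);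
  bm_S_back : forall w u v', vR w u -> vS (f w) (f u) v' ->
    exists v, vS w u v /\ f v = v'
}.

(** Pulling the valuation back along [f] settles atoms. For [Rhd], going to [F] lifts the challenge
    by [R_back] and maps the reply by [S_forth]; going to [G] uses [R_forth] and [S_back]. *)
Lemma forces_bounded_morphism (G F : veltman_frame) (f : G -> F)
    (ev : valuation F) (a : formula) :
  bounded_morphism G F f ->
  forall w, forces G (fun p v => ev p (f v)) w a <-> forces F ev (f w) a.
Proof.
  intros [R_forth R_back S_forth S_back].
  induction a as [p | | b IHb c IHc | b IHb | b IHb c IHc]; intros w; simpl.
  - reflexivity.
  - reflexivity.
  - rewrite IHb, IHc. reflexivity.
  - split; intros H.
    + intros v' Hv'. destruct (R_back _ _ Hv') as [v [Hv <-]].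
      apply IHb, H, Hv.
    + intros v Hv. apply IHb, H, R_forth, Hv.
  - split; intros H.
    + intros u' Hu' Hb. destruct (R_back _ _ Hu') as [u [Hu <-]].
      destruct (H u Hu) as [v [Hv Hc]].
      * apply IHb, Hb.
      * exists (f v). split; [apply S_forth, Hv | apply IHc, Hc].
    + intros u Hu Hb. destruct (H (f u)) as [v' [Hv' Hc]].
      * apply R_forth, Hu.
      * apply IHb, Hb.
      * destruct (S_back _ _ _ Hu Hv') as [v [Hv <-]].
        exists v. split; [exact Hv | apply IHc, Hc].
Qed.

Lemma validates_bounded_morphism (G F : veltman_frame) (f : G -> F)
    (a : formula) :
  bounded_morphism G F f -> (forall w', exists w, f w = w') ->
  validates G a -> validates F a.
Proof.
  intros Hf Hsurj HG ev w'. destruct (Hsurj w') as [w <-].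
  apply (forces_bounded_morphism G F f ev a Hf), HG.
Qed.

Lemma ranked_conv_wf (T : Type) (R : T -> T -> Prop) (rank : T -> nat) :
  (forall a b, R a b -> rank b < rank a) ->
  ~ exists c : nat -> T, forall n, R (c n) (c (S n)).
Proof.
  intros Hrank [c Hc].
  (* Each step of the chain costs at least one unit of rank, so the chain outlives its budget at
     [n = S (rank (c 0))]. *)
  assert (H : forall n, rank (c n) + n <= rank (c 0)).
  { induction n as [| n IHn]; [lia |].
    specialize (Hrank _ _ (Hc n)). lia. }
  specialize (H (S (rank (c 0)))). lia.
Qed.

(** One global preorder [le] containing [R] yields every [S_w] by restriction to [R[w]], so finite
    examples need only two tables and a rank. *)
Definition ranked_frame (T : Type) (t0 : T) (R le : T -> T -> Prop)
    (rank : T -> nat)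
    (R_tr : forall a b c, R a b -> R b c -> R a c)
    (R_rank : forall a b, R a b -> rank b < rank a)
    (le_refl : forall a, le a a)
    (le_tr : forall a b c, le a b -> le b c -> le a c)
    (R_le : forall a b, R a b -> le a b) : veltman_frame.
Proof.
  refine (VeltmanFrame T R (fun w a b => R w a /\ R w b /\ le a b)
            (inhabits t0) R_tr (ranked_conv_wf T R rank R_rank) _ _ _ _).
  - intros w a b H. tauto.
  - intros w a H. auto.
  - intros w a b c (? & ? & ?) (? & ? & ?). eauto.
  - intros w a b ? ? ?. auto.
Defined.

Inductive world : Type := X | Y | Z | U | V.

Definition world_R (a b : world) : Prop :=
  match a, b with
  | X, (Y | Z | U | V) | Y, V | Z, U => True
  | _, _ => False
  end.

(** The reflexive transitive closure of [world_R] with the pairs [Y], [Z] and [V], [U] added. *)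
Definition world_le (a b : world) : Prop :=
  match a, b with
  | X, _ | Y, (Y | Z | U | V) | Z, (Z | U) | U, U | V, (V | U) => True
  | _, _ => False
  end.

Definition world_rank (a : world) : nat :=
  match a with X => 2 | Y | Z => 1 | U | V => 0 end.

Definition non_pencil_frame : veltman_frame.
Proof.
  refine (ranked_frame world X world_R world_le world_rank _ _ _ _ _);
    repeat intros []; simpl; tauto || lia.
Defined.

Inductive split_world : Type := X' | Y' | Z' | U1 | U2 | V'.

Definition split_world_R (a b : split_world) : Prop :=
  match a, b with
  | X', (Y' | Z' | U1 | U2 | V') | Y', V' | Z', U1 => True
  | _, _ => False
  end.

(** The same closure over [split_world_R], where the added pairs are [Y'], [Z'] and [V'], [U2]. *)
Definition split_world_le (a b : split_world) : Prop :=
  match a, b with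
  | X', _ | Y', (Y' | Z' | U1 | U2 | V') | Z', (Z' | U1)
  | U1, U1 | U2, U2 | V', (V' | U2) => True
  | _, _ => False
  end.

Definition merge (a : split_world) : world :=
  match a with
  | X' => X | Y' => Y | Z' => Z | U1 => U | U2 => U | V' => V
  end.

Definition split_frame : veltman_frame.
Proof.
  refine (ranked_frame split_world X' split_world_R split_world_le
            (* [merge] preserves R, so the rank pulled back along it still drops. *)
            (fun a => world_rank (merge a)) _ _ _ _ _);
    repeat intros []; simpl; tauto || lia.
Defined.

Lemma non_pencil_frame_not_Pencil : ~ Pencil non_pencil_frame.
Proof.
  intros H. specialize (H X Y Z U V). simpl in H. tauto.
Qed.

(** The premises force [x = X']. If [y = Z'], then [v = u = U1], and Z' R U1. If [y = Y'], then
    [v = V'] and [u] is [V'], an R-successor of [Y'], or [U2], whose only R-predecessor [X'] cannot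
    be [z]. *)
Lemma split_frame_Pencil : Pencil split_frame.
Proof.
  intros x y z u v. simpl.
  destruct x, y; simpl; try tauto;
    destruct v; simpl; try tauto;
    destruct u; simpl; try tauto;
    destruct z; simpl; tauto.
Qed.

(** Only lifting [U] involves a choice: [Z'] and [U1] reach [U1], [V'] and [U2] reach [U2], and [X']
    and [Y'] can use either copy. *)
Lemma merge_bounded_morphism :
  bounded_morphism split_frame non_pencil_frame merge.
Proof.
  split; simpl.
  - intros [] []; simpl; tauto.
  - intros [] []; simpl; try tauto; intros _;
      solve [ exists X'; auto | exists Y'; auto | exists Z'; auto
            | exists U1; auto | exists U2; auto | exists V'; auto ].
  - intros [] [] []; simpl; tauto.
  - intros [] [] []; simpl; try tauto; intros _ _;
      solve [ exists X'; simpl; tauto | exists Y'; simpl; tauto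
            | exists Z'; simpl; tauto | exists U1; simpl; tauto
            | exists U2; simpl; tauto | exists V'; simpl; tauto ].
Qed.

Lemma merge_surjective (a : world) : exists b, merge b = a.
Proof.
  destruct a; [exists X' | exists Y' | exists Z' | exists U1 | exists V'];
    reflexivity.
Qed.

Theorem theorem3p1 :
  ~ exists phi : formula,
      forall F : veltman_frame, validates F phi <-> Pencil F.
Proof.
  intros [phi Hphi].
  apply non_pencil_frame_not_Pencil, Hphi.
  apply (validates_bounded_morphism split_frame non_pencil_frame merge).
  - exact merge_bounded_morphism.
  - exact merge_surjective.
  - apply Hphi, split_frame_Pencil.
Qed.
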